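(* For every positive integer $n$, the Eulerian numbers $(E(n,k),\ k\ge 0)$ form a log-concave sequence in $k$; that is, $E(n,k)^2\ge E(n,k-1)\,E(n,k+1)$ for all $k\ge 1$.
   Context: $E(n,k)$ denotes the Eulerian number, i.e. the number of permutations $\sigma$ of $\{1,\dots,n\}$ with exactly $k$ ascents, where an ascent is an index $j\in\{1,\dots,n-1\}$ with $\sigma(j)<\sigma(j+1)$ (so $E(n,k)=0$ for $k\ge n$). A sequence $(u(i),\ i\ge 0)$ of non-negative numbers is log-concave if $u(i)^2\ge u(i-1)u(i+1)$ for all $i\ge 1$. *)

(* Defs.v *)
From mathcomp Require Import all_boot all_fingroup.

Set Implicit Arguments.
Unset Strict Implicit.
Unset Printing Implicit Defensive.

(* Permutations of {1, ..., n} are encoded as permutations of {0, ..., n-1};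
   the last position n-1 has no successor, hence is never an ascent. *)
Definition ascents (n : nat) (s : 'S_n) : {set 'I_n} :=
  [set j : 'I_n | [exists k : 'I_n, (k == j.+1 :> nat) && (s j < s k)]].

Definition eulerian (n k : nat) : nat :=
  #|[set s : 'S_n | #|ascents s| == k]|.

Definition log_concave (u : nat -> nat) : Prop :=
  forall i : nat, 1 <= i -> u i.-1 * u i.+1 <= u i ^ 2.

(* Main.v *)
Require Import Defs.
From mathcomp Require Import all_boot all_fingroup.
From mathcomp Require Import zify.

Set Implicit Arguments.
Unset Strict Implicit.
Unset Printing Implicit Defensive.

(** The proof is an induction on [n] along the triangular recurrence
      [E(n+1, k+1) = (k+2) E(n, k+1) + (n-k) E(n, k)],  [E(n+1, 0) = E(n, 0)].

    The recurrence ([eulerianS0], [eulerianSS]) comes from inserting a new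
    maximum [n] into a permutation of [{0, ..., n-1}].  Put in front, or between
    the two terms of an ascent, the maximum leaves the number of ascents as it
    is; at any other place it creates one ascent ([card_ascents_lift_perm]).
    So a permutation with [a] ascents has [a+1] extensions with [a] ascents and
    [n-a] extensions with [a+1] ascents.

    That the recurrence preserves log-concavity ([log_concave_step]) is an
    inequality between four consecutive terms [x, y, z, w] of the old row.
    Besides [xz <= y^2] and [yw <= z^2] it uses [xw <= yz]; this follows from the
    other two unless [y] or [z] vanishes, so the induction also carries the fact
    that a row which reaches [0] stays at [0].  Then the difference of the two
    sides is a combination, with non-negative coefficients, of these three
    inequalities and the square [(y-z)^2] ([log_concave_step_ineq]). *)

(** * Ascents after inserting a maximum *)

(** The word of [s], continued by zeros: a last position can then be compared
    with its successor like any other, and is never an ascent. *)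
Definition perm_word (n : nat) (s : 'S_n) (j : nat) : nat :=
  if insub j is Some i then nat_of_ord (s i) else 0.

Lemma perm_word_ord n (s : 'S_n) (i : 'I_n) : perm_word s i = s i.
Proof. by rewrite /perm_word valK. Qed.

Lemma perm_word_out n (s : 'S_n) j : n <= j -> perm_word s j = 0.
Proof. by move=> le_nj; rewrite /perm_word insubN // -leqNgt. Qed.

Lemma mem_ascents n (s : 'S_n) (j : 'I_n) :
  (j \in ascents s) = (perm_word s j < perm_word s j.+1).
Proof.
rewrite inE perm_word_ord; apply/existsP/idP => [[k /andP[/eqP <-]]|].
  by rewrite perm_word_ord.
case: (ltnP j.+1 n) => [lt_jn | le_nj]; last by rewrite perm_word_out.
rewrite (perm_word_ord s (Ordinal lt_jn)) => lt_s.
by exists (Ordinal lt_jn); rewrite eqxx.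
Qed.

Lemma card_ascents_word n (s : 'S_n) :
  #|ascents s| = \sum_(0 <= j < n) (perm_word s j < perm_word s j.+1).
Proof.
rewrite big_mkord -sum1_card big_mkcond /=.
by apply: eq_bigr => j _; rewrite mem_ascents; case: ltnP.
Qed.

Lemma perm_word_lift_perm n (s : 'S_n) (i : 'I_n.+1) j :
  perm_word (lift_perm i ord_max s) j =
  if j < i then perm_word s j else if j == i then n else perm_word s j.-1.
Proof.
have [lt_jn | le_nj] := ltnP j n.+1; last first.
  rewrite perm_word_out // ifN ?ifN ?perm_word_out //;
    by move: (ltn_ord i); lia.
rewrite (perm_word_ord _ (Ordinal lt_jn)).
case: (unliftP i (Ordinal lt_jn)) => [k Ek | Ek]; last first.
  rewrite Ek lift_perm_id -[j]/(nat_of_ord (Ordinal lt_jn)) Ek.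
  by rewrite ltnn eqxx.
have Ej : j = bump i k by rewrite -[j]/(nat_of_ord (Ordinal lt_jn)) Ek.
rewrite Ek lift_perm_lift lift_max Ej /bump.
case: (leqP i k) => le_ik /=.
  by rewrite add1n add0n ltnNge leqW //= gtn_eqF ?ltnS // perm_word_ord.
by rewrite add0n le_ik perm_word_ord.
Qed.

(** The maximum put at position [j.+1] falls between the terms [j] and [j.+1] of
    the old word; the front has no term before it, hence the separate case. *)
Definition keeps_ascents (n : nat) (s : 'S_n) (i : 'I_n.+1) : bool :=
  if i : nat is j.+1 then perm_word s j < perm_word s j.+1 else true.

(** At the front the maximum starts a descent.  Elsewhere it replaces the
    comparison of two neighbours (at the end, of the last term with the zero
    after it) by an ascent followed by a descent. *)
Lemma card_ascents_lift_perm n (s : 'S_n) (i : 'I_n.+1) :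
  #|ascents (lift_perm i ord_max s)| = #|ascents s| + ~~ keeps_ascents s i.
Proof.
have ltw j : j < n -> perm_word s j < n.
  by move=> lt_jn; rewrite (perm_word_ord s (Ordinal lt_jn)).
have lew j : perm_word s j <= n.
  by case: (ltnP j n) => [/ltw/ltnW | /(perm_word_out s) ->].
set g := perm_word (lift_perm i ord_max s).
have gE := perm_word_lift_perm s i.
have gi : (g i < g i.+1) = false.
  rewrite /g !gE ltnn eqxx [i.+1 < i]ltnNge leqnSn /= gtn_eqF //.
  by rewrite ltnNge lew.
rewrite !card_ascents_word -/g.
have after : \sum_(i.+1 <= j < n.+1) (g j < g j.+1) =
             \sum_(i <= j < n) (perm_word s j < perm_word s j.+1).
  rewrite big_add1 /=; apply: eq_big_nat => j /andP[le_ij _].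
  by rewrite /g !gE !ifN //; lia.
have le_in : i <= n by rewrite -ltnS.
rewrite (@big_cat_nat _ _ _ i) //=; last by lia.
rewrite [X in _ + X]big_ltn // after gi add0n /keeps_ascents.
case Ei: (nat_of_ord i) => [|p]; first by rewrite big_geq // addn0.
have lt_pn : p < n by rewrite -Ei.
rewrite [X in _ = X + _](@big_cat_nat _ _ _ p.+1) //= !big_nat_recr //=.
have -> : g p < g p.+1.
  by rewrite /g !gE Ei ltnSn ltnn eqxx ltw.
have -> : \sum_(0 <= j < p) (g j < g j.+1) =
          \sum_(0 <= j < p) (perm_word s j < perm_word s j.+1).
  apply: eq_big_nat => j /andP[_ lt_jp].
  by rewrite /g !gE Ei ltnS (ltnW lt_jp) ltnS lt_jp.
by case: (_ < _); lia.
Qed.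

Lemma sum_keeps_ascents n (s : 'S_n) :
  \sum_(i < n.+1) keeps_ascents s i = #|ascents s|.+1.
Proof.
by rewrite big_ord_recl card_ascents_word big_mkord.
Qed.

(** * The Eulerian recurrence *)

Lemma lift_perm_max_bij n :
  bijective (fun p : 'I_n.+1 * 'S_n => lift_perm p.1 ord_max p.2).
Proof.
apply: inj_card_bij; last by rewrite card_prod !card_Sn card_ord factS.
case=> [i s] [i' s'] /= Es.
have Ei : i = i'.
  apply: (@perm_inj _ (lift_perm i ord_max s)).
  by rewrite {2}Es !lift_perm_id.
subst i'; congr pair; apply/permP => k.
have := congr1 (fun t : 'S_n.+1 => t (lift i k)) Es.
by rewrite /= !lift_perm_lift => /lift_inj.
Qed.

Lemma eulerianE n k : eulerian n k = \sum_(s : 'S_n) (#|ascents s| == k).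
Proof.
rewrite /eulerian -sum1_card big_mkcond /=.
by apply: eq_bigr => s _; rewrite inE; case: eqP.
Qed.

Lemma card_ascents_le n (s : 'S_n) : #|ascents s| <= n.
Proof. by rewrite -[X in _ <= X]card_ord max_card. Qed.

Lemma eulerian_gt n k : n < k -> eulerian n k = 0.
Proof.
move=> lt_nk; rewrite eulerianE big1 // => s _.
by case: eqP => // Ek; move: (card_ascents_le s); rewrite Ek leqNgt lt_nk.
Qed.

(** A permutation with [a] ascents is counted here with the number of its
    extensions that have [k] ascents. *)
Lemma eulerianS n k :
  eulerian n.+1 k =
  \sum_(s : 'S_n) (#|ascents s|.+1 * (#|ascents s| == k) +
                   (n - #|ascents s|) * (#|ascents s|.+1 == k)).
Proof.
rewrite eulerianE (reindex _ (onW_bij _ (lift_perm_max_bij n))) /=.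
rewrite -(pair_bigA _ (fun i s => #|ascents (lift_perm i ord_max s)| == k : nat)).
rewrite exchange_big /=; apply: eq_bigr => s _.
have <- : \sum_(i < n.+1) ~~ keeps_ascents s i = n - #|ascents s|.
  suff : \sum_(i < n.+1) keeps_ascents s i + \sum_(i < n.+1) ~~ keeps_ascents s i
       = n.+1 by rewrite sum_keeps_ascents; lia.
  rewrite -big_split /= -[RHS]card_ord -sum1_card.
  by apply: eq_bigr => i _; case: keeps_ascents.
rewrite -[X in X * _ + _]sum_keeps_ascents !big_distrl -big_split /=.
apply: eq_bigr => i _; rewrite card_ascents_lift_perm.
by case: keeps_ascents; rewrite ?addn0 ?addn1 ?mul1n.
Qed.

Lemma eulerianS0 n : eulerian n.+1 0 = eulerian n 0.
Proof.
rewrite eulerianS eulerianE; apply: eq_bigr => s _.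
by case: eqP => [->|_]; rewrite ?muln0 ?addn0.
Qed.

Lemma eulerianSS n k :
  eulerian n.+1 k.+1 = k.+2 * eulerian n k.+1 + (n - k) * eulerian n k.
Proof.
rewrite eulerianS !eulerianE !big_distrr -big_split /=.
apply: eq_bigr => s _; rewrite eqSS; congr (_ + _).
  by case: eqP => [->|_]; rewrite ?muln0.
by case: eqP => [->|_]; rewrite ?muln0.
Qed.

(** * Log-concavity along the recurrence *)

(** For a log-concave sequence this says that its support is an initial segment
    of the natural numbers, so that no zero lies between two positive terms. *)
Definition stays_zero (u : nat -> nat) : Prop :=
  forall k, u k = 0 -> u k.+1 = 0.

(** If the inner terms are positive, multiply the two inequalities centred at
    them and cancel their product; if one vanishes, so does the last term. *)
Lemma log_concave_outer_inner u :
  log_concave u -> stays_zero u ->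
  forall k, u k * u k.+3 <= u k.+1 * u k.+2.
Proof.
move=> lc sz k.
have [y0 | y_gt0] := posnP (u k.+1).
  by rewrite (sz _ (sz _ y0)) muln0.
have [z0 | z_gt0] := posnP (u k.+2).
  by rewrite (sz _ z0) muln0.
have yz_gt0 : 0 < u k.+1 * u k.+2 by rewrite muln_gt0 y_gt0.
rewrite -(leq_pmul2r yz_gt0).
have := leq_mul (lc k.+1 isT) (lc k.+2 isT); rewrite /=; congr (_ <= _); lia.
Qed.

Lemma log_concave_step_ineq k p x y z w :
  x * z <= y ^ 2 -> y * w <= z ^ 2 -> x * w <= y * z ->
  (k * y + p.+2 * x) * (k.+2 * w + p * z) <= (k.+1 * z + p.+1 * y) ^ 2.
Proof.
move=> xz yw xw.
have yz : 2 * (y * z) <= y ^ 2 + z ^ 2 by rewrite nat_Cauchy.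
have {}yw := leq_mul (leqnn (k * k.+2)) yw.
have {}xz := leq_mul (leqnn (p * p.+2)) xz.
have {}xw := leq_mul (leqnn (k.+2 * p.+2)) xw.
lia.
Qed.

Section EulerianStep.

Context (n : nat) (u v : nat -> nat).
Hypotheses (v0 : v 0 = u 0)
  (vS : forall k, v k.+1 = k.+2 * u k.+1 + (n - k) * u k).

Lemma stays_zero_step : stays_zero u -> stays_zero v.
Proof.
move=> sz [|k].
  by rewrite v0 vS => u0; rewrite (sz _ u0) u0 !muln0.
rewrite !vS => /eqP; rewrite addn_eq0 muln_eq0 /= => /andP[/eqP uk _].
by rewrite (sz _ uk) uk !muln0.
Qed.

Lemma log_concave_step :
  log_concave u -> stays_zero u -> (forall k, n < k -> u k = 0) ->
  log_concave v.
Proof.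
move=> lc sz u_gt [//|k] _ /=.
have [le_nk | lt_kn] := leqP n k.
  have -> : v k.+2 = 0 by rewrite vS u_gt ?muln0 //; nia.
  by rewrite muln0.
have En : n - k = (n - k.+1).+1 by lia.
rewrite (vS k.+1) (vS k) En.
case: k lt_kn {En} => [|k] lt_kn.
  (* The row has no entry before the first, so [x = 0]. *)
  have := @log_concave_step_ineq 1 (n - 1) 0 (u 0) (u 1) (u 2).
  by rewrite v0 muln0 addn0 mul1n; apply=> //; apply: (lc 1).
have -> : v k.+1 = k.+2 * u k.+1 + (n - k.+2).+2 * u k.
  by rewrite vS; congr (_ + _ * _); lia.
apply: log_concave_step_ineq; [exact: (lc k.+1) | exact: (lc k.+2) |].
exact: log_concave_outer_inner.
Qed.

End EulerianStep.

Lemma eulerian_log_concave_stays_zero n :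
  log_concave (eulerian n) /\ stays_zero (eulerian n).
Proof.
elim: n => [|n [lc sz]].
  by split=> [[//|i] _ | k _] /=; rewrite [eulerian 0 _.+1]eulerian_gt ?muln0.
split; last exact: (stays_zero_step (eulerianS0 n) (eulerianSS n)).
apply: (log_concave_step (eulerianS0 n) (eulerianSS n)) => //.
exact: eulerian_gt.
Qed.

Theorem theorem3p3 (n : nat) (hn : 0 < n) : log_concave (eulerian n).
Proof. by have [] := eulerian_log_concave_stays_zero n. Qed.
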